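(* Let $\phi:R\rightarrow S$ be a finite type ring map of commutative rings. Then $\phi$ is an epimorphism of rings if and only if the induced map $\phi^{\ast}:\operatorname{Spec}(S)\rightarrow\operatorname{Spec}(R)$ is injective and, for each prime ideal $\mathfrak{q}$ of $S$, the base change map $\kappa(\mathfrak{p})\rightarrow S_{\mathfrak{q}}\otimes_{R}\kappa(\mathfrak{p})$ is an isomorphism, where $\mathfrak{p}=\phi^{\ast}(\mathfrak{q})$.
   Context: All rings are commutative (with unit). An epimorphism of rings means an epimorphism in the category of commutative rings. A ring map $\phi:R\to S$ is of finite type if $S$ is finitely generated as an $R$-algebra via $\phi$. The map $\phi^{\ast}$ is $\mathfrak{q}\mapsto\phi^{-1}(\mathfrak{q})$. For a prime $\mathfrak{p}$ of $R$, $\kappa(\mathfrak{p})=R_{\mathfrak{p}}/\mathfrak{p}R_{\mathfrak{p}}$ is the residue field of $R$ at $\mathfrak{p}$. The base change map $\kappa(\mathfrak{p})\rightarrow S_{\mathfrak{q}}\otimes_{R}\kappa(\mathfrak{p})$ is $x\mapsto 1\otimes x$, i.e. the base change along $R\to\kappa(\mathfrak{p})$ of the composite $R\xrightarrow{\phi}S\to S_{\mathfrak{q}}$. *)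

(* Defs.v *)
From HB Require Import structures.
From mathcomp Require Import all_boot all_algebra.
From mathcomp Require Import boolp ring.

Set Implicit Arguments.
Unset Strict Implicit.
Unset Printing Implicit Defensive.

Import GRing.Theory.
Local Open Scope ring_scope.
Local Open Scope quotient_scope.

(* Commutative rings are [comPzRingType]s, so that the zero ring is included.
   The ideals of [ring_quotient] only live in nontrivial rings, hence the
   separate notion of prime ideal below; the localization at a prime ideal is
   nontrivial, and there the library ideals are used. *)

Definition finite_type (R S : comPzRingType) (phi : {rmorphism R -> S}) : Prop :=
  exists s : seq S, forall A : {pred S},
    GRing.subring_closed A -> (forall r, phi r \in A) -> {subset s <= A} ->
    forall x, x \in A.

Definition ring_epimorphism (R S : comPzRingType) (phi : {rmorphism R -> S}) :
    Prop :=
  forall (T : comPzRingType) (f g : {rmorphism S -> T}),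
    f \o phi =1 g \o phi -> f =1 g.

Definition prime_ideal (R : comPzRingType) (I : {pred R}) : Prop :=
  [/\ 0 \in I,
      {in I &, forall x y, x + y \in I},
      forall a, {in I, forall x, a * x \in I},
      1 \notin I
    & forall x y, x * y \in I -> (x \in I) || (y \in I)].

Record spec (R : comPzRingType) := Spec {
  spec_pred :> {pred R};
  specP : prime_ideal spec_pred }.

Lemma spec_map_subproof (R S : comPzRingType) (phi : {rmorphism R -> S})
  (q : spec S) : prime_ideal [pred x | phi x \in q].
Proof.
case: q => I [/= I0 ID IM I1 Ip]; split; rewrite ?inE ?rmorph0 ?rmorph1 //=.
- by move=> x y; rewrite !inE rmorphD; apply: ID.
- by move=> a x; rewrite !inE rmorphM; apply: IM.
- by move=> x y; rewrite !inE rmorphM; apply: Ip.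
Qed.

Definition spec_map (R S : comPzRingType) (phi : {rmorphism R -> S})
  (q : spec S) : spec R := Spec (spec_map_subproof phi q).

Section Localization.
Variables (R : comPzRingType) (p : spec R).

Lemma spec0 : 0 \in p. Proof. by case: (specP p). Qed.
Lemma specD x y : x \in p -> y \in p -> x + y \in p.
Proof. by case: (specP p) => _ H _ _ _; apply: H. Qed.
Lemma specMl a x : x \in p -> a * x \in p.
Proof. by case: (specP p) => _ _ H _ _; apply: H. Qed.
Lemma spec1 : 1 \notin p. Proof. by case: (specP p). Qed.
Lemma specNM x y : x \notin p -> y \notin p -> x * y \notin p.
Proof.
case: (specP p) => _ _ _ _ H px py; apply/negP => /H.
by rewrite (negPf px) (negPf py).
Qed.

Definition loc_den := {s : R | s \notin p}.
Definition loc_frac := (R * loc_den)%type.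

Definition den1 : loc_den := exist _ 1 spec1.
Definition denM (s t : loc_den) : loc_den :=
  exist _ (sval s * sval t) (specNM (valP s) (valP t)).

Definition loc_equiv (x y : loc_frac) : bool :=
  `[< exists u : loc_den, sval u * (x.1 * sval y.2) = sval u * (y.1 * sval x.2) >].

Lemma loc_equiv_is_equiv : equiv_class_of loc_equiv.
Proof.
split=> [x|x y|y x z].
- by apply/asboolP; exists den1.
- by apply/idP/idP => /asboolP[u e]; apply/asboolP; exists u.
- move=> /asboolP[u e] /asboolP[v e']; apply/asboolP.
  exists (denM (denM u v) y.2); rewrite /=.
  set a := sval u in e *; set b := sval v in e' *; set c := sval y.2 in e e' *.
  transitivity (b * sval z.2 * (a * (x.1 * c))); first by ring.
  rewrite e; transitivity (a * sval x.2 * (b * (y.1 * sval z.2))); first by ring.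
  by rewrite e'; ring.
Qed.

Canonical loc_equiv_equiv := EquivRelPack loc_equiv_is_equiv.
Canonical loc_equiv_encModRel := defaultEncModRel loc_equiv.

Definition localization := {eq_quot loc_equiv}.

HB.instance Definition _ : EqQuotient loc_frac loc_equiv localization :=
  EqQuotient.on localization.
HB.instance Definition _ := Choice.on localization.

Lemma loc_eqP (x y : loc_frac) :
  reflect (exists u : loc_den,
             sval u * (x.1 * sval y.2) = sval u * (y.1 * sval x.2))
          (x == y %[mod localization]).
Proof. by rewrite piE; apply: asboolP. Qed.

Definition frac0 : loc_frac := (0, den1).
Definition frac1 : loc_frac := (1, den1).
Definition fracN (x : loc_frac) : loc_frac := (- x.1, x.2).
Definition fracD (x y : loc_frac) : loc_frac :=
  (x.1 * sval y.2 + y.1 * sval x.2, denM x.2 y.2).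
Definition fracM (x y : loc_frac) : loc_frac := (x.1 * y.1, denM x.2 y.2).

Definition loc0 : localization := lift_cst localization frac0.
Definition loc1 : localization := lift_cst localization frac1.
Definition locN := lift_op1 localization fracN.
Definition locD := lift_op2 localization fracD.
Definition locM := lift_op2 localization fracM.

Canonical pi_loc0 := PiConst loc0.
Canonical pi_loc1 := PiConst loc1.

Lemma repr_locP (x : loc_frac) : exists u : loc_den,
  sval u * ((repr (\pi_localization x)).1 * sval x.2)
  = sval u * (x.1 * sval (repr (\pi_localization x)).2).
Proof. by apply/loc_eqP; rewrite reprK. Qed.

Lemma pi_locN : {morph \pi_localization : x / fracN x >-> locN x}.
Proof.
move=> x; unlock locN; apply/eqP/loc_eqP; have [u e] := repr_locP x.
by exists u; rewrite /= !mulNr !mulrN e.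
Qed.
Canonical pi_locN_morph := PiMorph1 pi_locN.

Lemma pi_locD : {morph \pi_localization : x y / fracD x y >-> locD x y}.
Proof.
move=> x y; unlock locD; apply/eqP/loc_eqP.
have [u] := repr_locP x; have [v] := repr_locP y.
move: (repr _) (repr _) => x' y' ey ex; exists (denM u v) => /=.
transitivity
  (sval v * sval y.2 * sval y'.2 * (sval u * (x.1 * sval x'.2)) +
   sval u * sval x.2 * sval x'.2 * (sval v * (y.1 * sval y'.2))); first by ring.
by rewrite -ex -ey; ring.
Qed.
Canonical pi_locD_morph := PiMorph2 pi_locD.

Lemma pi_locM : {morph \pi_localization : x y / fracM x y >-> locM x y}.
Proof.
move=> x y; unlock locM; apply/eqP/loc_eqP.
have [u] := repr_locP x; have [v] := repr_locP y.
move: (repr _) (repr _) => x' y' ey ex; exists (denM u v) => /=.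
transitivity ((sval u * (x.1 * sval x'.2)) * (sval v * (y.1 * sval y'.2))).
  by ring.
by rewrite -ex -ey; ring.
Qed.
Canonical pi_locM_morph := PiMorph2 pi_locM.

Lemma locDA : associative locD.
Proof.
elim/quotW=> x; elim/quotW=> y; elim/quotW=> z; rewrite !piE.
by apply/eqP/loc_eqP; exists den1; rewrite /=; ring.
Qed.

Lemma locDC : commutative locD.
Proof.
elim/quotW=> x; elim/quotW=> y; rewrite !piE.
by apply/eqP/loc_eqP; exists den1; rewrite /=; ring.
Qed.

Lemma loc0D : left_id loc0 locD.
Proof.
elim/quotW=> x; rewrite !piE.
by apply/eqP/loc_eqP; exists den1; rewrite /=; ring.
Qed.

Lemma locND : left_inverse loc0 locN locD.
Proof.
elim/quotW=> x; rewrite !piE.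
by apply/eqP/loc_eqP; exists den1; rewrite /=; ring.
Qed.

HB.instance Definition _ :=
  GRing.isZmodule.Build localization locDA locDC loc0D locND.

Lemma locMA : associative locM.
Proof.
elim/quotW=> x; elim/quotW=> y; elim/quotW=> z; rewrite !piE.
by apply/eqP/loc_eqP; exists den1; rewrite /=; ring.
Qed.

Lemma locMC : commutative locM.
Proof.
elim/quotW=> x; elim/quotW=> y; rewrite !piE.
by apply/eqP/loc_eqP; exists den1; rewrite /=; ring.
Qed.

Lemma loc1M : left_id loc1 locM.
Proof.
elim/quotW=> x; rewrite !piE.
by apply/eqP/loc_eqP; exists den1; rewrite /=; ring.
Qed.

Lemma locMDl : left_distributive locM locD.
Proof.
elim/quotW=> x; elim/quotW=> y; elim/quotW=> z; rewrite !piE.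
by apply/eqP/loc_eqP; exists den1; rewrite /=; ring.
Qed.

Lemma loc1_neq0 : loc1 != 0.
Proof.
rewrite -[0]/loc0 piE; apply/negP => /asboolP[[u pu]] /=.
by rewrite !mul0r mulr0 !mulr1 => u0; rewrite u0 spec0 in pu.
Qed.

HB.instance Definition _ := GRing.Zmodule_isComNzRing.Build localization
  locMA locMC loc1M locMDl loc1_neq0.

Definition loc_map (x : R) : localization := \pi_localization (x, den1).

Lemma loc_map_is_zmod_morphism : zmod_morphism loc_map.
Proof.
move=> x y; rewrite /loc_map [X in _ = X]piE; apply/eqP/loc_eqP.
by exists den1; rewrite /=; ring.
Qed.
HB.instance Definition _ :=
  GRing.isZmodMorphism.Build R localization loc_map loc_map_is_zmod_morphism.

Lemma loc_map_is_monoid_morphism : monoid_morphism loc_map.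
Proof.
split=> [|x y]; rewrite /loc_map [RHS]piE; apply/eqP/loc_eqP;
  by exists den1; rewrite /=; ring.
Qed.
HB.instance Definition _ :=
  GRing.isMonoidMorphism.Build R localization loc_map loc_map_is_monoid_morphism.

(* The ideal p R_p. *)
Definition loc_max : {pred localization} :=
  fun z => `[< exists x : loc_frac, x.1 \in p /\ z = \pi_localization x >].

Lemma loc_max_idealr_closed : idealr_closed loc_max.
Proof.
split.
- by apply/asboolP; exists frac0; split; [apply: spec0|rewrite [LHS]piE].
- apply/negP => /asboolP[[x [s ps]] [/= px]] /eqP.
  rewrite -[1]/loc1 piE => /asboolP[[u pu]] /=.
  rewrite mul1r mulr1 => e; have := specNM pu ps.
  by rewrite e specMl.
- elim/quotW=> a _ _ /asboolP[x [px ->]] /asboolP[y [py ->]].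
  apply/asboolP; exists (fracD (fracM a x) y); split; last by rewrite !piE.
  rewrite /= specD // mulrC; apply: specMl => //; exact: specMl.
Qed.
HB.instance Definition _ :=
  isIdealr.Build localization loc_max loc_max_idealr_closed.

Definition residue := {ideal_quot loc_max}.
HB.instance Definition _ := GRing.ComNzRing.on residue.

Definition residue_map : R -> residue := \pi_residue \o loc_map.
HB.instance Definition _ := GRing.RMorphism.on residue_map.

End Localization.

Section Tensor.
Variables (R A B : comPzRingType).
Variables (f : {rmorphism R -> A}) (g : {rmorphism R -> B}).

(* A formal sum of elementary tensors is a list of pairs. The congruence
   generated by the bilinearity relations turns the free commutative monoid on
   A x B into the tensor product over R; opposites come for free, as
   (-a) (x) b is inverse to a (x) b. *)
Inductive tens_cong : seq (A * B) -> seq (A * B) -> Prop :=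
| TensRefl s : tens_cong s s
| TensSym s t : tens_cong s t -> tens_cong t s
| TensTrans s t u : tens_cong s t -> tens_cong t u -> tens_cong s u
| TensCat s s' t t' :
    tens_cong s s' -> tens_cong t t' -> tens_cong (s ++ t) (s' ++ t')
| TensCatC s t : tens_cong (s ++ t) (t ++ s)
| Tens0l b : tens_cong [:: (0, b)] [::]
| Tens0r a : tens_cong [:: (a, 0)] [::]
| TensDl a a' b : tens_cong [:: (a + a', b)] [:: (a, b); (a', b)]
| TensDr a b b' : tens_cong [:: (a, b + b')] [:: (a, b); (a, b')]
| TensZ r a b : tens_cong [:: (f r * a, b)] [:: (a, g r * b)].

Definition tens_equiv (s t : seq (A * B)) : bool := `[< tens_cong s t >].

Lemma tens_equiv_is_equiv : equiv_class_of tens_equiv.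
Proof.
split=> [s|s t|t s u].
- by apply/asboolP/TensRefl.
- by apply/idP/idP => /asboolP e; apply/asboolP/TensSym.
- by move=> /asboolP e /asboolP e'; apply/asboolP/(TensTrans e).
Qed.

Canonical tens_equiv_equiv := EquivRelPack tens_equiv_is_equiv.
Canonical tens_equiv_encModRel := defaultEncModRel tens_equiv.

Definition tensor := {eq_quot tens_equiv}.

HB.instance Definition _ : EqQuotient (seq (A * B)) tens_equiv tensor :=
  EqQuotient.on tensor.
HB.instance Definition _ := Choice.on tensor.

Lemma tens_eqP (s t : seq (A * B)) :
  reflect (tens_cong s t) (s == t %[mod tensor]).
Proof. by rewrite piE; apply: asboolP. Qed.

Lemma repr_tensP (s : seq (A * B)) : tens_cong (repr (\pi_tensor s)) s.
Proof. by apply/tens_eqP; rewrite reprK. Qed.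

Definition fsumN (s : seq (A * B)) := [seq (- x.1, x.2) | x <- s].
Definition fsumM (s t : seq (A * B)) :=
  [seq (x.1 * y.1, x.2 * y.2) | x <- s, y <- t].

Lemma cong_perm s t : perm_eq s t -> tens_cong s t.
Proof.
elim: s t => [|x s IHs] t.
  by rewrite perm_sym => /perm_size/size0nil ->; apply: TensRefl.
move=> e; have := perm_mem e x; rewrite mem_head => /esym xt.
case/splitPr: xt e => t1 t2; rewrite perm_sym perm_catC /= perm_cons => e.
apply: (@TensTrans _ ([:: x] ++ (t2 ++ t1))).
  by apply: (TensCat (TensRefl [:: x])); apply: IHs; rewrite perm_sym.
exact: (TensCatC (x :: t2) t1).
Qed.

Lemma cong_cons x s t : tens_cong s t -> tens_cong (x :: s) (x :: t).
Proof. exact: (TensCat (TensRefl [:: x])). Qed.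

Lemma fsumN_cong s t : tens_cong s t -> tens_cong (fsumN s) (fsumN t).
Proof.
rewrite /fsumN; elim=> {s t} [s|s t _|s t u _ IH _|s s' t t' _ IH _ IH'|s t
  |b|a|a a' b|a b b'|r a b] /=.
- exact: TensRefl.
- exact: TensSym.
- exact: TensTrans.
- by rewrite !map_cat; apply: TensCat.
- by rewrite !map_cat; apply: TensCatC.
- by rewrite oppr0; apply: Tens0l.
- exact: Tens0r.
- by rewrite opprD; apply: TensDl.
- exact: TensDr.
- by rewrite -mulrN; apply: TensZ.
Qed.

Lemma cong_Nr a b : tens_cong [:: (a, - b)] [:: (- a, b)].
Proof.
have TensNr c : tens_cong ([:: (a, - c)] ++ [:: (a, c)]) [::].
  apply: (TensTrans (TensSym (TensDr _ _ _))).
  by rewrite addNr; apply: Tens0r.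
have TensNl : tens_cong ([:: (a, b)] ++ [:: (- a, b)]) [::].
  apply: (TensTrans (TensSym (TensDl _ _ _))).
  by rewrite subrr; apply: Tens0l.
apply: (@TensTrans _ ([:: (a, - b)] ++ ([:: (a, b)] ++ [:: (- a, b)]))).
  exact: (TensCat (TensRefl [:: (a, - b)]) (TensSym TensNl)).
by rewrite catA; apply: (TensCat (TensNr b) (TensRefl [:: (- a, b)])).
Qed.

Lemma fsumM_catl s s' t : fsumM (s ++ s') t = fsumM s t ++ fsumM s' t.
Proof. exact: allpairs_cat. Qed.

Lemma fsumM_consl x s t :
  fsumM (x :: s) t = [seq (x.1 * y.1, x.2 * y.2) | y <- t] ++ fsumM s t.
Proof. by []. Qed.

Lemma fsumM_nilr s : fsumM s [::] = [::].
Proof. by elim: s. Qed.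

Lemma fsumM_consr s y t : tens_cong (fsumM s (y :: t))
  (fsumM s [:: y] ++ fsumM s t).
Proof.
apply: cong_perm; elim: s => //= x s IHs.
rewrite !fsumM_consl /= perm_cons.
by rewrite [X in perm_eq _ X]/= perm_sym perm_catCA perm_cat2l perm_sym.
Qed.

Lemma fsumMC s t : tens_cong (fsumM s t) (fsumM t s).
Proof.
elim: s t => [|x s IHs] t; first by rewrite fsumM_nilr; apply: TensRefl.
apply: TensSym; apply: (TensTrans (fsumM_consr _ _ _)).
rewrite fsumM_consl; apply: TensCat; last exact/TensSym/IHs.
elim: t => [|y t IHt] /=; first exact: TensRefl.
by rewrite (mulrC x.1) (mulrC x.2); apply: cong_cons.
Qed.

Lemma fsumM_congl s s' t : tens_cong s s' -> tens_cong (fsumM s t) (fsumM s' t).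
Proof.
have base u v : (forall y, tens_cong (fsumM u [:: y]) (fsumM v [:: y])) ->
    tens_cong (fsumM u t) (fsumM v t).
  move=> uv; elim: t => [|y t IHt].
    by rewrite !fsumM_nilr; apply: TensRefl.
  apply: (TensTrans (fsumM_consr _ _ _)).
  apply: (TensTrans _ (TensSym (fsumM_consr _ _ _))).
  exact: TensCat.
elim=> {s s'} [s|s u _|s u v _ IH _|s s' u u' _ IH _ IH'|s u
  |b|a|a a' b|a b b'|r a b].
- exact: TensRefl.
- exact: TensSym.
- exact: TensTrans.
- by rewrite !fsumM_catl; apply: TensCat.
- by rewrite !fsumM_catl; apply: TensCatC.
- by apply: base => y; rewrite /fsumM /= mul0r; apply: Tens0l.
- by apply: base => y; rewrite /fsumM /= mul0r; apply: Tens0r.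
- by apply: base => y; rewrite /fsumM /= mulrDl; apply: TensDl.
- by apply: base => y; rewrite /fsumM /= mulrDl; apply: TensDr.
- by apply: base => y; rewrite /fsumM /= -!mulrA; apply: TensZ.
Qed.

Lemma fsumM_cong s s' t t' :
  tens_cong s s' -> tens_cong t t' -> tens_cong (fsumM s t) (fsumM s' t').
Proof.
move=> ss tt; apply: (TensTrans (fsumM_congl _ ss)).
apply: (TensTrans (fsumMC _ _)); apply: (TensTrans (fsumM_congl _ tt)).
exact: fsumMC.
Qed.

Definition tens0 : tensor := lift_cst tensor [::].
Definition tens1 : tensor := lift_cst tensor [:: (1, 1)].
Definition tensN := lift_op1 tensor fsumN.
Definition tensD := lift_op2 tensor cat.
Definition tensM := lift_op2 tensor fsumM.

Canonical pi_tens0 := PiConst tens0.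
Canonical pi_tens1 := PiConst tens1.

Lemma pi_tensN : {morph \pi_tensor : s / fsumN s >-> tensN s}.
Proof.
move=> s; unlock tensN; apply/eqP/tens_eqP/fsumN_cong/TensSym.
exact: repr_tensP.
Qed.
Canonical pi_tensN_morph := PiMorph1 pi_tensN.

Lemma pi_tensD : {morph \pi_tensor : s t / s ++ t >-> tensD s t}.
Proof.
move=> s t; unlock tensD; apply/eqP/tens_eqP/TensSym.
by apply: TensCat; apply: repr_tensP.
Qed.
Canonical pi_tensD_morph := PiMorph2 pi_tensD.

Lemma pi_tensM : {morph \pi_tensor : s t / fsumM s t >-> tensM s t}.
Proof.
move=> s t; unlock tensM; apply/eqP/tens_eqP/TensSym.
by apply: fsumM_cong; apply: repr_tensP.
Qed.
Canonical pi_tensM_morph := PiMorph2 pi_tensM.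

Lemma tensDA : associative tensD.
Proof.
by elim/quotW=> x; elim/quotW=> y; elim/quotW=> z; rewrite !piE catA.
Qed.

Lemma tensDC : commutative tensD.
Proof.
elim/quotW=> x; elim/quotW=> y; rewrite !piE.
exact/eqP/tens_eqP/TensCatC.
Qed.

Lemma tens0D : left_id tens0 tensD.
Proof. by elim/quotW=> x; rewrite !piE. Qed.

Lemma tensND : left_inverse tens0 tensN tensD.
Proof.
elim/quotW=> s; rewrite !piE; apply/eqP/tens_eqP.
elim: s => [|[a b] s IHs] /=; first exact: TensRefl.
apply: (@TensTrans _ ([:: (- a, b); (a, b)] ++ (fsumN s ++ s))).
  by apply: cong_perm; rewrite /= perm_cons -cat1s perm_catCA.
apply: (TensTrans _ IHs).
apply: (TensCat _ (TensRefl _) (s' := [::])).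
apply: (TensTrans (TensSym (TensDl _ _ _))).
by rewrite addNr; apply: Tens0l.
Qed.

HB.instance Definition _ :=
  GRing.isZmodule.Build tensor tensDA tensDC tens0D tensND.

Lemma fsumMA s t u : fsumM s (fsumM t u) = fsumM (fsumM s t) u.
Proof.
elim: s => // x s IHs; rewrite !fsumM_consl fsumM_catl IHs; congr cat.
elim: t {IHs} => // y t IHt; rewrite /= !fsumM_consl map_cat IHt.
congr cat; rewrite -map_comp; apply: eq_map => z /=.
by rewrite !mulrA.
Qed.

Lemma tensMA : associative tensM.
Proof.
by elim/quotW=> x; elim/quotW=> y; elim/quotW=> z; rewrite !piE fsumMA.
Qed.

Lemma tensMC : commutative tensM.
Proof.
elim/quotW=> x; elim/quotW=> y; rewrite !piE.
exact/eqP/tens_eqP/fsumMC.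
Qed.

Lemma tens1M : left_id tens1 tensM.
Proof.
elim/quotW=> x; rewrite !piE /fsumM /= cats0; congr (\pi _).
by rewrite -[RHS]map_id; apply: eq_map => -[a b] /=; rewrite !mul1r.
Qed.

Lemma tensMDl : left_distributive tensM tensD.
Proof.
elim/quotW=> x; elim/quotW=> y; elim/quotW=> z.
by rewrite !piE fsumM_catl.
Qed.

HB.instance Definition _ := GRing.Zmodule_isComPzRing.Build tensor
  tensMA tensMC tens1M tensMDl.

Definition tens (a : A) (b : B) : tensor := \pi_tensor [:: (a, b)].

Definition tens_inl (a : A) : tensor := tens a 1.
Definition tens_inr (b : B) : tensor := tens 1 b.

Lemma tens_bal r : tens_inl (f r) = tens_inr (g r).
Proof.
apply/eqP/tens_eqP; have := TensZ r 1 1; rewrite !mulr1; exact.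
Qed.

Lemma tens_inl_is_zmod_morphism : zmod_morphism tens_inl.
Proof.
move=> x y; rewrite /tens_inl /tens [RHS]piE.
exact/eqP/tens_eqP/TensDl.
Qed.
HB.instance Definition _ :=
  GRing.isZmodMorphism.Build A tensor tens_inl tens_inl_is_zmod_morphism.

Lemma tens_inl_is_monoid_morphism : monoid_morphism tens_inl.
Proof.
split=> [|x y]; rewrite /tens_inl /tens [RHS]piE //.
by rewrite /fsumM /= mulr1.
Qed.
HB.instance Definition _ :=
  GRing.isMonoidMorphism.Build A tensor tens_inl tens_inl_is_monoid_morphism.

Lemma tens_inr_is_zmod_morphism : zmod_morphism tens_inr.
Proof.
move=> x y; rewrite /tens_inr /tens [RHS]piE.
apply/eqP/tens_eqP/(TensTrans (TensDr _ _ _))/cong_cons.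
rewrite /=; apply: (TensTrans _ (cong_Nr _ _)); exact: TensRefl.
Qed.
HB.instance Definition _ :=
  GRing.isZmodMorphism.Build B tensor tens_inr tens_inr_is_zmod_morphism.

Lemma tens_inr_is_monoid_morphism : monoid_morphism tens_inr.
Proof.
split=> [|x y]; rewrite /tens_inr /tens [RHS]piE //.
by rewrite /fsumM /= mulr1.
Qed.
HB.instance Definition _ :=
  GRing.isMonoidMorphism.Build B tensor tens_inr tens_inr_is_monoid_morphism.

End Tensor.

(* Main.v *)
Require Import Defs.
From HB Require Import structures.
From mathcomp Require Import all_boot all_algebra.
From mathcomp Require Import boolp classical_sets ring.

(* An epimorphism out of a field is surjective, and epimorphisms are stable
   under base change. So if phi is an epimorphism, then for every prime q over p
   both S (x) kappa(p) and S_q (x) kappa(p) are quotients of kappa(p). All points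
   of the fibre over p have therefore the same kernel, and
   kappa(p) -> S_q (x) kappa(p), whose target maps to kappa(q), is bijective.

   Conversely let f, g : S -> T agree on R, let D = f - g, and let J be the ideal
   generated by the values of D, which is finitely generated as phi is of finite
   type. A prime P of T pulls back under f and g to primes of S over the same
   prime p of R, hence to a single q. Surjectivity of
   kappa(p) -> S_q (x) kappa(p) = S_q / p S_q gives for each s in S some u not in
   q, and a, b in R with phi(b) not in q, such that u (phi(b) s - phi(a)) lies in
   p S. Applying D, which is R-linear, yields f(u) f(phi(b)) D(s) in P J, so
   J_P = P J_P, and J_P = 0 by Nakayama's lemma. Hence J = 0. *)

Set Implicit Arguments.
Unset Strict Implicit.
Unset Printing Implicit Defensive.

Import GRing.Theory.
Local Open Scope ring_scope.
Local Open Scope quotient_scope.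

(** * Maximal submodules and existence of primes *)

(** Ideals are the case [f = idfun], subspaces of an algebra over a field the case of its structure
    map; one Zorn argument serves both. *)
Definition submodule (R A : comPzRingType) (f : R -> A) (H : A -> Prop) : Prop :=
  [/\ H 0, forall x y, H x -> H y -> H (x + y) & forall r x, H x -> H (f r * x)].

Lemma submoduleB (R A : comPzRingType) (f : {rmorphism R -> A}) H x y :
  submodule f H -> H x -> H y -> H (x - y).
Proof.
move=> [H0 HD HM] Hx Hy; apply: HD => //.
by have := HM (-1) _ Hy; rewrite rmorphN1 mulN1r.
Qed.

(** Zorn's lemma for the submodules containing [I] and avoiding [e]. The last clause expresses
    maximality: [H + f(R) y] must reach [e]. *)
Lemma maximal_submodule (R A : comPzRingType) (f : {rmorphism R -> A})
    (I : A -> Prop) (e : A) :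
  submodule f I -> ~ I e ->
  exists H : A -> Prop, [/\ submodule f H, forall x, I x -> H x, ~ H e
    & forall y, ~ H y -> exists h r, H h /\ e = h + f r * y].
Proof.
move=> [I0 ID IM] Ie.
(* The empty set is admitted because it is the union of the empty chain. *)
pose Q (B : set A) := B = set0 \/
  [/\ submodule f B, forall x, I x -> B x & ~ B e].
have [F FQ Ftot|H [QH Hmax]] := @Zorn_bigcup A Q.
  have [[B [FB [x Bx]]]|Fempty] := pselect (exists B, F B /\ exists x, B x).
    have sub C y : F C -> C y -> [/\ submodule f C, forall x, I x -> C x & ~ C e].
      by move=> FC Cy; case: (FQ _ FC) => // C0; rewrite C0 in Cy.
    have [[B0 _ _] BI _] := sub _ _ FB Bx.
    right; split; first split.
    - by exists B.
    - move=> y z [C FC Cy] [D FD Dz].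
      have [[_ CD _] _ _] := sub _ _ FC Cy.
      have [[_ DD _] _ _] := sub _ _ FD Dz.
      case: (Ftot _ _ FC FD) => [CD'|DC].
        by exists D => //; apply: DD => //; apply: CD'.
      by exists C => //; apply: CD => //; apply: DC.
    - move=> r y [C FC Cy]; exists C => //.
      by have [[_ _ CM] _ _] := sub _ _ FC Cy; apply: CM.
    - by move=> y Iy; exists B => //; apply: BI.
    - by move=> [C FC Ce]; have [_ _] := sub _ _ FC Ce.
  left; apply/seteqP; split => // x [B FB Bx].
  by case: Fempty; exists B; split=> //; exists x.
(* The maximal element is not the empty set, since [I] is strictly larger. *)
have {QH}[[H0 HD HM] HI He] : [/\ submodule f H, forall x, I x -> H x & ~ H e].
  case: QH => // H0; exfalso; apply: (Hmax I); last by right.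
  by rewrite H0; split=> // /(_ _ I0).
exists H; split=> // y Hy; apply: contrapT => noe.
pose B x := exists h r, H h /\ x = h + f r * y.
have HB : (H `<=` B)%classic.
  by move=> x Hx; exists x, 0; rewrite rmorph0 mul0r addr0.
apply: (Hmax B).
  split=> // /(_ y) BH; apply/Hy/BH; exists 0, 1.
  by rewrite rmorph1 mul1r add0r.
right; split=> [|x /HI/HB//|//]; split; first exact/HB.
- move=> _ _ [h [r [Hh ->]]] [h' [r' [Hh' ->]]]; exists (h + h'), (r + r').
  by split; [apply: HD|rewrite rmorphD; ring].
- move=> s _ [h [r [Hh ->]]]; exists (f s * h), (s * r).
  by split; [apply: HM|rewrite rmorphM; ring].
Qed.

(** An ideal maximal among those avoiding 1 is prime: for x, y outside [H], multiply expressions of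
    1 in H + (x) and H + (y); if xy were in [H], so would be 1. *)
Lemma exists_prime (T : comPzRingType) (I : T -> Prop) :
  submodule (@idfun T) I -> ~ I 1 ->
  exists P : spec T, forall x, I x -> x \in P.
Proof.
move=> subI I1; have [H [[H0 HD HM] HI H1 Hmax]] := maximal_submodule subI I1.
suff Hp : prime_ideal [pred x | `[< H x >]].
  by exists (Spec Hp) => x /HI Hx; apply/asboolP.
split.
- exact/asboolP.
- by move=> x y /asboolP Hx /asboolP Hy; apply/asboolP/HD.
- by move=> a x /asboolP Hx; apply/asboolP/HM.
- by apply/asboolP.
- move=> x y /asboolP Hxy; apply: contrapT => /negP; rewrite negb_or.
  case/andP=> /asboolP Hx /asboolP Hy.
  have [h [r [Hh e]]] := Hmax _ Hx; have [h' [r' [Hh' e']]] := Hmax _ Hy.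
  apply: H1; rewrite -[1]mulr1 {1}e e' /=.
  have -> : (h + r * x) * (h' + r' * y)
    = (h' + r' * y) * h + (r * x * h' + (r * r') * (x * y)) by ring.
  by apply: (HD); [|apply: (HD)]; apply: HM.
Qed.

Lemma eq_spec (R : comPzRingType) (p q : spec R) : p =i q -> p = q.
Proof.
case: p q => [p pP] [q qP] pq.
have e : p = q by apply/funext => x; exact: pq.
by case: q / e qP {pq} => qP; congr Spec; apply: Prop_irrelevance.
Qed.

(** * Fractions and residue fields *)

(** Universal property of fractions, for any [L] whose elements are quotients [l a / l b]. It yields
    maps out of a residue field in one step, without separating localization from quotient. *)
Lemma fraction_lift (R L T : comPzRingType) (l : {rmorphism R -> L})
    (h : {rmorphism R -> T}) (D : R -> Prop) :
  D 1 -> (forall x y, D x -> D y -> D (x * y)) ->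
  (forall c, exists a b, D b /\ c * l b = l a) ->
  (forall b, D b -> exists t, t * h b = 1) ->
  (forall x, l x = 0 -> h x = 0) ->
  exists k : {rmorphism L -> T}, forall x, k (l x) = h x.
Proof.
move=> D1 DM frac hunit hker.
have hinj b t u : D b -> t * h b = u * h b -> t = u.
  move=> /hunit[v vb] e.
  by rewrite -[t]mulr1 -[u]mulr1 -vb [v * _]mulrC !mulrA e.
(* The value at [c] is required to fit every presentation of [c] as a fraction; any two
   presentations agree by [hker]. *)
have /choice[k kP] : forall c, exists t, forall a b, D b -> c * l b = l a ->
    t * h b = h a.
  move=> c; have [a [b [Db e]]] := frac c; have [v vb] := hunit _ Db.
  exists (h a * v) => a' b' Db' e'.
  have : h (a * b') = h (a' * b).
    apply/eqP; rewrite -subr_eq0 -rmorphB; apply/eqP/hker.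
    by rewrite rmorphB !rmorphM -e -e'; ring.
  rewrite !rmorphM => e2.
  by rewrite mulrAC e2 -mulrA [h b * _]mulrC vb mulr1.
have kl x : k (l x) = h x.
  by rewrite -[LHS]mulr1 -(rmorph1 h); apply: kP; rewrite ?rmorph1 ?mulr1.
have kB : zmod_morphism k.
  move=> c c'; have [a [b [Db e]]] := frac c.
  have [a' [b' [Db' e']]] := frac c'.
  apply: (hinj (b * b')); first exact: DM.
  rewrite (kP _ (a * b' - a' * b)); last 2 first.
  - exact: DM.
  - by rewrite rmorphB !rmorphM -e -e'; ring.
  by rewrite rmorphB !rmorphM -(kP _ _ _ Db e) -(kP _ _ _ Db' e'); ring.
have kM : monoid_morphism k.
  split=> [|c c']; first by rewrite -(rmorph1 l) kl rmorph1.
  have [a [b [Db e]]] := frac c; have [a' [b' [Db' e']]] := frac c'.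
  apply: (hinj (b * b')); first exact: DM.
  rewrite (kP _ (a * a')); last 2 first.
  - exact: DM.
  - by rewrite !rmorphM -e -e'; ring.
  by rewrite !rmorphM -(kP _ _ _ Db e) -(kP _ _ _ Db' e'); ring.
pose ka := GRing.isZmodMorphism.Build L T k kB.
pose km := GRing.isMonoidMorphism.Build L T k kM.
pose K : {rmorphism L -> T} := HB.pack k ka km.
by exists K.
Qed.

Section ResidueField.
Variables (R : comPzRingType) (p : spec R).

Lemma loc_frac_ex (z : localization p) :
  exists a b, b \notin p /\ z * loc_map p b = loc_map p a.
Proof.
elim/quotW: z => -[a [b pb]]; exists a, b; split=> //.
rewrite [LHS]piE; apply/eqP/loc_eqP.
by exists (den1 p); rewrite /=; ring.
Qed.

Lemma loc_map_eq0 x : loc_map p x = 0 -> exists2 u, u \notin p & u * x = 0.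
Proof.
rewrite -[0]/(loc0 p) [RHS]piE => /eqP/loc_eqP[[u pu] /=].
by rewrite mulr1 mul0r mulr0 => e; exists u.
Qed.

Lemma loc_map_unit b : b \notin p -> exists t, t * loc_map p b = 1.
Proof.
move=> pb; exists (\pi_(localization p) (1, exist _ b pb)).
rewrite -[RHS]/(loc1 p) !piE; apply/eqP/loc_eqP.
by exists (den1 p); rewrite /=; ring.
Qed.

Lemma residue_frac_ex (c : residue p) :
  exists a b, b \notin p /\ c * residue_map p b = residue_map p a.
Proof.
elim/quotW: c => z; have [a [b [pb e]]] := loc_frac_ex z; exists a, b.
by split=> //; rewrite /residue_map /= -e rmorphM.
Qed.

(** If x/1 = a/b with a in p, then u x b = u a lies in p for some u outside p, and primality puts x
    in p. *)
Lemma residue_map_eq0 x : (residue_map p x == 0) = (x \in p).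
Proof.
rewrite /residue_map /= -(rmorph0 (\pi_(residue p))) -Quotient.idealrBE subr0.
apply/idP/idP => [/asboolP[[a [b pb]] [/= pa]]|px]; last first.
  by apply/asboolP; exists (x, den1 p).
move=> /eqP/loc_eqP[[u pu] /=]; rewrite mulr1 => e.
apply: contraT => px; have := specNM pu (specNM px pb).
by rewrite e specMl.
Qed.

Lemma residue_map_unit b : b \notin p -> exists t, t * residue_map p b = 1.
Proof.
move=> /loc_map_unit[t e]; exists (\pi_(residue p) t).
by rewrite /residue_map /= -rmorphM e rmorph1.
Qed.

Lemma residue_lift (T : comPzRingType) (h : {rmorphism R -> T}) :
  (forall b, b \notin p -> exists t, t * h b = 1) ->
  {in p, forall x, h x = 0} ->
  exists k : {rmorphism residue p -> T}, forall x, k (residue_map p x) = h x.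
Proof.
move=> hu h0; apply: (@fraction_lift _ _ _ _ _ (fun b => b \notin p)) => //.
- exact: spec1.
- exact: specNM.
- exact: residue_frac_ex.
- by move=> x /eqP; rewrite residue_map_eq0 => /h0.
Qed.

Lemma residue_field (c : residue p) : c <> 0 -> exists d, d * c = 1.
Proof.
have [a [b [pb e]]] := residue_frac_ex c => c0.
have [t tb] := residue_map_unit pb.
have ce : c = t * residue_map p a by rewrite -e mulrCA tb mulr1.
have [pa|/residue_map_unit[s sa]] := boolP (a \in p).
  by case: c0; rewrite ce; move: pa; rewrite -residue_map_eq0 => /eqP->; rewrite mulr0.
exists (s * residue_map p b).
by rewrite -mulrA [_ * c]mulrC e sa.
Qed.

End ResidueField.

(** * Maps out of the tensor product *)

Section TensorSums.
Variables (R A B : comPzRingType).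
Variables (f : {rmorphism R -> A}) (g : {rmorphism R -> B}).

(** Checked on each generator of the congruence; a balanced biadditive [beta] thus descends to the
    tensor product. *)
Lemma tens_cong_sum (V : zmodType) (beta : A -> B -> V) :
  (forall b, {morph beta^~ b : x y / x + y}) ->
  (forall a, {morph beta a : x y / x + y}) ->
  (forall r a b, beta (f r * a) b = beta a (g r * b)) ->
  forall s t, tens_cong f g s t ->
    \sum_(x <- s) beta x.1 x.2 = \sum_(x <- t) beta x.1 x.2.
Proof.
move=> bDl bDr bZ.
have b0l b : beta 0 b = 0 by apply: (addrI (beta 0 b)); rewrite -bDl !addr0.
have b0r a : beta a 0 = 0 by apply: (addrI (beta a 0)); rewrite -bDr !addr0.
move=> s t; elim=> {s t} //=.
- by move=> s t u _ -> _ ->.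
- by move=> s s' t t' _ e _ e'; rewrite !big_cat /= e e'.
- by move=> s t; rewrite !big_cat /= addrC.
- by move=> b; rewrite big_nil big_seq1 b0l.
- by move=> a; rewrite big_nil big_seq1 b0r.
- by move=> a a' b; rewrite !big_cons !big_nil /= !addr0 bDl.
- by move=> a b b'; rewrite !big_cons !big_nil /= !addr0 bDr.
- by move=> r a b; rewrite !big_seq1; apply: bZ.
Qed.

Lemma tensE a b : tens f g a b = tens_inl f g a * tens_inr f g b.
Proof. by rewrite [RHS]piE /fsumM /= mulr1 mul1r. Qed.

Lemma pi_tens_sum s :
  \pi_(tensor f g) s = \sum_(x <- s) tens_inl f g x.1 * tens_inr f g x.2.
Proof.
elim: s => [|[a b] s IHs].
  by rewrite big_nil -[RHS]/(tens0 f g) [RHS]piE.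
by rewrite big_cons /= -tensE -IHs [RHS]piE.
Qed.

Lemma tens_lift (T : comPzRingType) (u : {rmorphism A -> T})
    (v : {rmorphism B -> T}) :
  (forall r, u (f r) = v (g r)) ->
  exists w : {rmorphism tensor f g -> T},
    (forall a, w (tens_inl f g a) = u a) /\ (forall b, w (tens_inr f g b) = v b).
Proof.
move=> uv; pose w (z : tensor f g) := \sum_(x <- repr z) u x.1 * v x.2.
have wE s : w (\pi s) = \sum_(x <- s) u x.1 * v x.2.
  apply: (@tens_cong_sum _ (fun a b => u a * v b)); last exact: repr_tensP.
  - by move=> b x y; rewrite rmorphD mulrDl.
  - by move=> a x y; rewrite rmorphD mulrDr.
  - by move=> r a b; rewrite !rmorphM uv; ring.
have wl a : w (tens_inl f g a) = u a.
  by rewrite [LHS](wE [:: (a, 1)]) big_seq1 /= rmorph1 mulr1.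
have wr b : w (tens_inr f g b) = v b.
  by rewrite [LHS](wE [:: (1, b)]) big_seq1 /= rmorph1 mul1r.
have wB : zmod_morphism w.
  elim/quotW=> s; elim/quotW=> t; rewrite !wE [X in w X]piE wE big_cat /=.
  congr (_ + _); rewrite /fsumN big_map /= -sumrN.
  by apply: eq_bigr => x _; rewrite rmorphN mulNr.
have wM : monoid_morphism w.
  split; first by rewrite -(rmorph1 (tens_inl f g)) wl rmorph1.
  elim/quotW=> s; elim/quotW=> t; rewrite !wE [X in w X]piE wE.
  rewrite /fsumM big_allpairs_dep /= mulr_suml; apply: eq_bigr => x _.
  by rewrite mulr_sumr; apply: eq_bigr => y _; rewrite !rmorphM; ring.
pose wa := GRing.isZmodMorphism.Build (tensor f g) T w wB.
pose wm := GRing.isMonoidMorphism.Build (tensor f g) T w wM.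
pose W : {rmorphism tensor f g -> T} := HB.pack w wa wm.
by exists W.
Qed.

(** Two maps agreeing on [B] agree on the image of [R] in [A], hence on [A]; the images of [A] and
    [B] generate the tensor product. *)
Lemma epi_tens_inr : ring_epimorphism f -> ring_epimorphism (tens_inr f g).
Proof.
move=> epi T u v uv z.
have uvl : u \o tens_inl f g =1 v \o tens_inl f g.
  by apply: epi => r /=; rewrite tens_bal; apply: uv.
elim/quotW: z => s; rewrite pi_tens_sum !rmorph_sum; apply: eq_bigr => x _.
by rewrite !rmorphM; have /= -> := uvl x.1; have /= -> := uv x.2.
Qed.

End TensorSums.

(** * Consequences of being an epimorphism *)

(* A maximal [K]-subspace [H] avoiding [1] and containing [x] is the kernel of a
   linear form [m] with [m 1 = 1] and [m x = 0]; contracting [x (x) 1 = 1 (x) x]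
   with [m] gives [x = 0]. *)
Lemma epi_field_surj (K F : comPzRingType) (i : {rmorphism K -> F}) :
  (forall c : K, c <> 0 -> exists d, d * c = 1) ->
  ring_epimorphism i -> forall x, exists c, i c = x.
Proof.
move=> Kfield epi x; apply: contrapT => xi.
have [||H [subH HI H1 Hmax]] :=
    @maximal_submodule _ _ i (fun y => exists c, y = i c * x) 1.
- split; first by exists 0; rewrite rmorph0 mul0r.
  + by move=> _ _ [c ->] [d ->]; exists (c + d); rewrite rmorphD mulrDl.
  + by move=> r _ [c ->]; exists (r * c); rewrite rmorphM mulrA.
(* If 1 = i(c) x, then x is i of the inverse of c; if c = 0, then [F] is the zero ring and x =
   i(0). *)
- move=> [c e]; apply: xi; have [c0|/Kfield[d dc]] := pselect (c = 0).
    exists 0; rewrite rmorph0; move: e; rewrite c0 rmorph0 mul0r => e.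
    by rewrite -[x]mul1r e mul0r.
  exists d; rewrite -[LHS]mulr1 e mulrA -rmorphM dc rmorph1 mul1r //.
have [H0 HD HM] := subH.
(* [F] is the direct sum of [i(K)] and [H], and [m] is the coordinate on [i(K)]; uniqueness is
   [mE]. *)
have /choice[m mP] : forall y, exists c, H (y - i c).
  move=> y; have [Hy|/Hmax[h [r [Hh e]]]] := pselect (H y).
    by exists 0; rewrite rmorph0 subr0.
  have [r0|/Kfield[d dr]] := pselect (r = 0).
    by case: H1; rewrite e r0 rmorph0 mul0r addr0.
  exists d; have -> : y - i d = i (- d) * h; last exact: HM.
  have {1}-> : i d = i d * h + y.
    by rewrite -[LHS]mulr1 e mulrDr mulrA -rmorphM dr rmorph1 mul1r.
  by rewrite rmorphN; ring.
have mE y c : H (y - i c) -> m y = c.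
  move=> Hc; apply: contrapT => ne.
  have /Kfield[d e] : c - m y <> 0.
    by move=> /eqP; rewrite subr_eq0 => /eqP/esym.
  apply: H1; rewrite -(rmorph1 i) -e rmorphM; apply: HM.
  have -> : i (c - m y) = (y - i (m y)) - (y - i c) by rewrite rmorphB; ring.
  exact: (submoduleB subH).
have m1 : m 1 = 1 by apply: mE; rewrite rmorph1 subrr.
have mx : m x = 0.
  by apply: mE; rewrite rmorph0 subr0; apply: HI; exists 1; rewrite rmorph1 mul1r.
(* The two inclusions into the tensor square agree on [K], hence at [x]. *)
have /eqP/tens_eqP/tens_cong_sum : tens_inl i i x = tens_inr i i x.
  by apply: epi => c /=; apply: tens_bal.
move=> /(_ F (fun a b => i (m a) * b)) /=; rewrite !big_seq1 /= mx m1.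
rewrite rmorph0 rmorph1 !mul0r mul1r => e; apply: xi; exists 0.
rewrite rmorph0; apply: e.
- move=> b y z /=; rewrite -mulrDl -rmorphD; congr (i _ * b); apply: mE.
  have -> : y + z - i (m y + m z) = (y - i (m y)) + (z - i (m z)).
    by rewrite rmorphD; ring.
  exact: HD.
- by move=> a y z; rewrite mulrDr.
- move=> r a b; have -> : m (i r * a) = r * m a; last by rewrite rmorphM; ring.
  apply: mE; rewrite rmorphM -mulrBr; exact: HM.
Qed.

(** A map out of S_q is determined by its restriction to S, because inverses are unique. *)
Lemma epi_comp_loc (R S : comPzRingType) (phi : {rmorphism R -> S}) (q : spec S) :
  ring_epimorphism phi -> ring_epimorphism (loc_map q \o phi).
Proof.
move=> epi T f g fg z.
have fgl : f \o loc_map q =1 g \o loc_map q by apply: epi => r; apply: fg.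
have [a [b [/(loc_map_unit (p := q))[t tb] e]]] := loc_frac_ex z.
have inv (k : {rmorphism localization q -> T}) : k z = k (loc_map q a) * k t.
  by rewrite -rmorphM -e -mulrA [loc_map q b * t]mulrC tb mulr1.
have ft : f t = g t.
  have h (k : {rmorphism localization q -> T}) : k t * k (loc_map q b) = 1.
    by rewrite -rmorphM tb rmorph1.
  have /= eb := fgl b.
  by rewrite -[LHS]mulr1 -(h g) -eb mulrA [f t * _]mulrC -mulrA h mulr1.
by rewrite !inv ft; have /= -> := fgl a.
Qed.

Section ResidueMaps.
Variables (R S : comPzRingType) (phi : {rmorphism R -> S}) (q : spec S).
Let p := spec_map phi q.

Lemma residue_functorial : exists k : {rmorphism residue p -> residue q},
  forall x, k (residue_map p x) = residue_map q (phi x).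
Proof.
have [|x|k kE] := @residue_lift _ p _ (residue_map q \o phi); last by exists k.
- by move=> b; rewrite inE => /residue_map_unit.
- by rewrite inE -residue_map_eq0 => /eqP.
Qed.

End ResidueMaps.

Lemma residue_rmorph_inj (R T : comPzRingType) (p : spec R)
    (k : {rmorphism residue p -> T}) :
  (1 : T) <> 0 -> injective k.
Proof.
move=> T1 x y e; apply: contrapT => xy.
have [d dc] : exists d, d * (x - y) = 1.
  by apply: residue_field => /eqP; rewrite subr_eq0 => /eqP.
apply: T1.
by rewrite -(rmorph1 k) -dc rmorphM rmorphB e subrr mulr0.
Qed.

(** Each s satisfies s (x) 1 = 1 (x) c with c in kappa(p), and for every q over p, s lies in q
    exactly when c = 0, a condition on p alone. *)
Lemma epi_spec_map_inj (R S : comPzRingType) (phi : {rmorphism R -> S}) :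
  ring_epimorphism phi -> injective (spec_map phi).
Proof.
move=> epi q1 q2 e; pose p := spec_map phi q1.
have surj : forall x, exists c, tens_inr phi (residue_map p) c = x.
  by apply: epi_field_surj; [exact: residue_field|exact: epi_tens_inr].
(* Every point of the fibre over [p] has the same kernel. *)
have ker q : spec_map phi q = p ->
    forall s c, tens_inr phi (residue_map p) c = tens_inl phi (residue_map p) s ->
    (s \in q) = (c == 0).
  move=> qp s c sc.
  (* Stated with [p] so that rewriting along [qp] transports the map between residue fields. *)
  have : exists k : {rmorphism residue p -> residue q},
      forall x, k (residue_map p x) = residue_map q (phi x).
    by rewrite -qp; apply: residue_functorial.
  case=> k kE.
  have [|w [wl wr]] := @tens_lift _ _ _ phi (residue_map p) _ (residue_map q) k.
    by move=> r; rewrite kE.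
  rewrite -residue_map_eq0 -wl -sc wr -(inj_eq (residue_rmorph_inj (k := k) _)).
    by rewrite rmorph0.
  by apply/eqP; apply: oner_neq0.
apply: eq_spec => s; have [c sc] := surj (tens_inl phi (residue_map p) s).
by rewrite (ker q1 erefl s c sc) (ker q2 (esym e) s c sc).
Qed.

(** Surjectivity is that of an epimorphism out of a field; injectivity holds because the target maps
    to kappa(q) and so is nonzero. *)
Lemma epi_residue_bij (R S : comPzRingType) (phi : {rmorphism R -> S})
    (q : spec S) :
  ring_epimorphism phi ->
  bijective (tens_inr (loc_map q \o phi) (residue_map (spec_map phi q))).
Proof.
move=> epi; set i := tens_inr _ _.
have surj : forall x, exists c, i c = x.
  apply: epi_field_surj; first exact: residue_field.
  exact/epi_tens_inr/epi_comp_loc.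
have [g gP] := choice surj.
have inj : injective i.
  have [k kE] := residue_functorial phi q.
  pose l : {rmorphism localization q -> residue q} := \pi_(residue q).
  have [|w [wl wr]] := @tens_lift _ _ _ (loc_map q \o phi)
    (residue_map (spec_map phi q)) _ l k; first by move=> r; rewrite kE.
  apply: residue_rmorph_inj => /(congr1 w) /eqP.
  by rewrite rmorph1 rmorph0 oner_eq0.
by exists g => [c|x]; [apply: inj; rewrite gP|rewrite gP].
Qed.

(** * Products of ideals and Nakayama's lemma *)

(** For an ideal [P] this is the product of [P] with the ideal generated by [X]; for [P] everywhere
    true, that ideal itself. *)
Inductive mul_span (T : comPzRingType) (P X : T -> Prop) : T -> Prop :=
| MulSpan0 : mul_span P X 0
| MulSpanD r x z : P r -> X x -> mul_span P X z -> mul_span P X (r * x + z).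

Section MulSpan.
Variable T : comPzRingType.
Implicit Types P X : T -> Prop.

Lemma mul_spanD P X y z : mul_span P X y -> mul_span P X z -> mul_span P X (y + z).
Proof.
move=> yP zP; elim: yP => [|r x {}y Pr Xx _ IH]; first by rewrite add0r.
by rewrite -addrA; apply: MulSpanD.
Qed.

Lemma mul_spanM P P' X a : (forall r, P r -> P' (a * r)) ->
  forall z, mul_span P X z -> mul_span P' X (a * z).
Proof.
move=> PP' z; elim=> {z} [|r x z Pr Xx _ IH]; first by rewrite mulr0; left.
by rewrite mulrDr mulrA; apply: MulSpanD => //; apply: PP'.
Qed.

Lemma mul_span_spec (p : spec T) X z : mul_span (fun r => r \in p) X z -> z \in p.
Proof.
elim=> {z} [|r x z pr _ _ pz]; first exact: spec0.
by apply: specD => //; rewrite mulrC; apply: specMl.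
Qed.

Lemma mul_span_cons (p : spec T) y ys z :
  mul_span (fun r => r \in p) (fun x => x \in y :: ys) z ->
  exists r w, [/\ r \in p, mul_span (fun r => r \in p) (fun x => x \in ys) w
    & z = r * y + w].
Proof.
elim=> {z} [|r x z pr xys _ [r' [w [pr' wP ->]]]].
  by exists 0, 0; split; [exact: spec0|left|rewrite mul0r addr0].
move: xys; rewrite inE => /predU1P[->|xys].
  by exists (r + r'), w; split=> //; [exact: specD|ring].
by exists r', (r * x + w); split=> //; [exact: MulSpanD|ring].
Qed.

Lemma specDr (p : spec T) x y : x \in p -> (y + x \in p) = (y \in p).
Proof.
move=> px; apply/idP/idP => [|py]; last exact: specD.
by move=> /specD/(_ (specMl (-1) px)); rewrite mulN1r addrK.
Qed.

(* Nakayama's lemma at the prime [p], relative to the submodule [N]. *)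
Lemma local_nakayama (p : spec T) (xs : seq T) (N : T -> Prop) :
  submodule (@idfun T) N ->
  (forall x, x \in xs -> exists c n w, [/\ c \notin p, N n,
    mul_span (fun r => r \in p) (fun x => x \in xs) w & c * x = n + w]) ->
  forall x, x \in xs -> exists2 c, c \notin p & N (c * x).
Proof.
elim: xs N => [|y ys IH] N subN //= H.
have [N0 ND NM] := subN.
(* Induction on the generators: those in [ys] are treated modulo [N + T y]. *)
pose N' z := exists n t, N n /\ z = n + t * y.
have subN' : submodule (@idfun T) N'.
  split; first by exists 0, 0; split=> //; rewrite mul0r addr0.
  - move=> _ _ [n [t [Nn ->]]] [n' [t' [Nn' ->]]].
    by exists (n + n'), (t + t'); split; [exact: ND|ring].
  - move=> r _ [n [t [Nn ->]]].
    by exists (r * n), (r * t); split; [exact: NM|rewrite /=; ring].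
have ysN' x : x \in ys -> exists2 c, c \notin p & N' (c * x).
  apply: IH => // {}x xys.
  have [|c [n [w [pc Nn /mul_span_cons[r [w' [_ w'P ->]]] e]]]] := H x.
    by rewrite inE xys orbT.
  exists c, (n + r * y), w'; split=> //; last by rewrite e; ring.
  by exists n, r.
(* Up to a factor outside p, p times the span of [ys] lies in N + p y: the coefficients on y keep a
   factor from p. *)
have spanN' w : mul_span (fun r => r \in p) (fun x => x \in ys) w ->
    exists c n r, [/\ c \notin p, N n, r \in p & c * w = n + r * y].
  elim=> {w} [|r x z pr /ysN'[c pc [n [t [Nn e]]]] _].
    exists 1, 0, 0; split=> //; [exact: spec1|exact: spec0|ring].
  move=> [c' [n' [r' [pc' Nn' pr' e']]]].
  exists (c * c'), (c' * r * n + c * n'), (c' * t * r + c * r'); split.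
  - exact: specNM.
  - by apply: ND; apply: NM.
  - by apply: specD; apply: specMl.
  - transitivity (c' * r * (c * x) + c * (c' * z)); first by ring.
    by rewrite e e'; ring.
have [cy pcy Ny] : exists2 c, c \notin p & N (c * y).
  have [|c [n [w [pc Nn /mul_span_cons[r [w' [pr w'P ->]]] e]]]] := H y.
    by rewrite inE eqxx.
  have [c' [n' [r' [pc' Nn' pr' e']]]] := spanN' _ w'P.
  (* Modulo [N], c y = r y + w' and c' w' = r' y, so this factor kills y; it is outside p because r
     and r' are in p. *)
  exists (c' * c + (- c' * r + -1 * r')).
    by rewrite specDr ?specNM //; apply: specD; apply: specMl.
  have -> : (c' * c + (- c' * r + -1 * r')) * y = c' * n + n'; last first.
    by apply: (ND) => //; apply: NM.
  transitivity (c' * (c * y) - c' * r * y - r' * y); first by ring.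
  by rewrite e; transitivity (c' * n + c' * w' - r' * y); [|rewrite e']; ring.
move=> x; rewrite inE => /predU1P[->|/ysN'[c pc [n [t [Nn e]]]]].
  by exists cy.
exists (cy * c); first exact: specNM.
rewrite -mulrA e; have -> : cy * (n + t * y) = cy * n + t * (cy * y) by ring.
by apply: ND; apply: NM.
Qed.

End MulSpan.

(** * The local ring of the fibre, S_q / p S_q *)

Section FibreQuotient.
Variables (R S : comPzRingType) (phi : {rmorphism R -> S}) (q : spec S).
Let p := spec_map phi q.

(** The extended ideal p S. *)
Definition ext_ideal : S -> Prop :=
  mul_span (fun a => exists2 r, phi r \in q & a = phi r) (fun=> True).

Lemma ext_idealM a t : ext_ideal t -> ext_ideal (a * t).
Proof.
elim=> {t} [|r x t pr _ _ IH]; first by rewrite mulr0; left.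
by rewrite mulrDr mulrCA; apply: MulSpanD.
Qed.

Lemma ext_ideal_sub t : ext_ideal t -> t \in q.
Proof.
elim=> {t} [|_ x t [r qr ->] _ _ qt]; first exact: spec0.
by apply: specD => //; rewrite mulrC; apply: specMl.
Qed.

(* The ideal p S_q; the map of [S_q] onto its quotient extends to
   [S_q (x) kappa(p)]. *)
Definition ext_loc : {pred localization q} := fun z =>
  `[< exists u t, [/\ u \notin q, ext_ideal t
                   & loc_map q u * z = loc_map q t] >].

Lemma ext_loc_idealr_closed : idealr_closed ext_loc.
Proof.
split.
- apply/asboolP; exists 1, 0; split; [exact: spec1|left|].
  by rewrite mulr0 rmorph0.
- apply/negP => /asboolP[u [t [qu /ext_ideal_sub qt]]].
  rewrite mulr1 => /eqP; rewrite -subr_eq0 -rmorphB => /eqP/loc_map_eq0[v qv].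
  rewrite mulrBr => /eqP; rewrite subr_eq0 => /eqP e.
  by have := specNM qv qu; rewrite e specMl.
- move=> a z z' /asboolP[u [t [qu tP e]]] /asboolP[u' [t' [qu' tP' e']]].
  have [a0 [v [qv ea]]] := loc_frac_ex a.
  apply/asboolP; exists (v * (u * u')), (a0 * u' * t + v * u * t'); split.
  + by do 2!apply: specNM => //.
  + by apply: mul_spanD; apply: ext_idealM.
  + by rewrite rmorphD !rmorphM /= -e -e' -ea; ring.
Qed.
HB.instance Definition _ :=
  isIdealr.Build (localization q) ext_loc ext_loc_idealr_closed.

(** Surjectivity gives s (x) 1 = 1 (x) a/b. Mapping to S_q / p S_q yields b s = a there, and [u]
    clears the denominators. *)
Lemma fibre_fraction (s : S) :
  (forall z, exists c, tens_inr (loc_map q \o phi) (residue_map p) c = z) ->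
  exists u a b, [/\ u \notin q, phi b \notin q
                  & ext_ideal (u * (phi b * s - phi a))].
Proof.
move=> surj; pose Q := {ideal_quot ext_loc}.
pose l : {rmorphism localization q -> Q} := \pi_Q.
have [b|x|k kE] := @residue_lift _ p _ (l \o (loc_map q \o phi)).
- rewrite inE => /(loc_map_unit (p := q))[t e]; exists (l t).
  by rewrite /= -rmorphM e rmorph1.
- rewrite inE => qx; apply/eqP; rewrite -(rmorph0 l) -Quotient.idealrBE subr0.
  apply/asboolP; exists 1, (phi x * 1 + 0); split; first exact: spec1.
    by apply: MulSpanD => //; [exists x|left].
  by rewrite rmorph1 mul1r mulr1 addr0.
have [|w [wl wr]] := @tens_lift _ _ _ (loc_map q \o phi) (residue_map p) _ l k.
  by move=> r; rewrite kE.
have [c sc] := surj (tens_inl _ _ (loc_map q s)).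
have [a [b [pb e]]] := residue_frac_ex c.
have : l (loc_map q (phi b * s)) == l (loc_map q (phi a)).
  apply/eqP; have := kE a; rewrite -e rmorphM kE -wr sc wl /= => <-.
  by rewrite !rmorphM mulrC.
rewrite -Quotient.idealrBE -rmorphB => /asboolP[u [t [qu tP]]].
rewrite -rmorphM => /eqP; rewrite -subr_eq0 -rmorphB => /eqP/loc_map_eq0[v qv].
rewrite mulrBr => /eqP; rewrite subr_eq0 => /eqP et.
exists (v * u), a, b; split=> //; first exact: specNM.
by rewrite -mulrA et; apply: ext_idealM.
Qed.

End FibreQuotient.

(** * The converse implication *)

Lemma fibrewise_epi (R S : comPzRingType) (phi : {rmorphism R -> S}) :
  finite_type phi -> injective (spec_map phi) ->
  (forall (q : spec S) z,
     exists c, tens_inr (loc_map q \o phi) (residue_map (spec_map phi q)) c = z) ->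
  ring_epimorphism phi.
Proof.
move=> [gens ft] inj surj T f g fg s; pose D x := f x - g x.
pose xs := map D gens.
pose J := mul_span (fun _ : T => True) (fun x => x \in xs).
have JM a z : J z -> J (a * z) by apply: mul_spanM.
(* The x with [D x] in [J] form a subring, by D(yz) = f(y) D(z) + g(z) D(y). *)
have DJ x : J (D x).
  apply/asboolP; apply: (ft [pred x | `[< J (D x) >]]).
  - split; first by apply/asboolP; rewrite /D !rmorph1 subrr; left.
    + move=> y z /asboolP Jy /asboolP Jz; apply/asboolP.
      have -> : D (y - z) = D y + (-1) * D z by rewrite /D !rmorphB; ring.
      by apply: mul_spanD => //; apply: JM.
    + move=> y z /asboolP Jy /asboolP Jz; apply/asboolP.
      have -> : D (y * z) = f y * D z + g z * D y by rewrite /D !rmorphM; ring.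
      by apply: mul_spanD => //; apply: JM.
  - by move=> r; apply/asboolP; rewrite /D; have /= -> := fg r; rewrite subrr; left.
  - move=> y ys; apply/asboolP; rewrite -[D y]addr0 -[D y]mul1r.
    by apply: MulSpanD => //; [exact: map_f|left].
have killed (P : spec T) : forall x, x \in xs -> exists2 c, c \notin P & c * x = 0.
  have qE : spec_map f P = spec_map g P.
    by apply: inj; apply: eq_spec => r; rewrite !inE; have /= -> := fg r.
  set q := spec_map f P in qE.
  have qf t : (f t \in P) = (t \in q) by [].
  have qg t : (g t \in P) = (t \in q) by rewrite qE.
  pose PJ := mul_span (fun r => r \in P) (fun x => x \in xs).
  have PJM a z : PJ z -> PJ (a * z) by apply: mul_spanM => r; apply: specMl.
  (* [D] is R-linear, and [f (phi r)] lies in [P] when [phi r] lies in [q]. *)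
  have DPJ t : ext_ideal phi q t -> PJ (D t).
    elim=> {t} [|_ t z [r qr ->] _ _ IH]; first by rewrite /D !rmorph0 subrr; left.
    have -> : D (phi r * t + z) = f (phi r) * D t + D z.
      by rewrite /D !rmorphD !rmorphM; have /= -> := fg r; ring.
    apply: mul_spanD => //; apply: mul_spanM (DJ t) => a _.
    by rewrite mulrC; apply: specMl; rewrite qf.
  apply: (@local_nakayama _ P xs (fun x => x = 0)).
    by split=> // [x y -> ->|r x ->]; rewrite ?addr0 ?mulr0.
  move=> _ /mapP[t _ ->].
  have [u [a [b [qu qb wP]]]] := fibre_fraction t (surj q).
  set w := phi b * t - phi a in wP.
  (* Since D(w) = f(phi b) D(t), the Leibniz rule gives f(u) f(phi b) D(t) = D(u w) - g(w) D(u).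
     Here u w is in p S, and w is in q because u is not. *)
  exists (f u * f (phi b)), 0, (D (u * w) + (- g w) * D u); split=> //.
  - by apply: specNM; rewrite qf.
  - apply: mul_spanD; first exact: DPJ.
    apply: mul_spanM (DJ u) => c _; rewrite mulrC; apply: specMl.
    rewrite -mulN1r; apply: specMl; rewrite qg.
    apply: contraT => qw; have := specNM qu qw.
    by rewrite (ext_ideal_sub wP).
  - rewrite /D /w !rmorphM !rmorphB !rmorphM.
    by have /= -> := fg a; have /= -> := fg b; ring.
(* The annihilator of [D s] lies in no prime, so it contains 1. *)
pose ann a := a * D s = 0.
have [a1|a1] := pselect (ann 1).
  by apply/eqP; rewrite -subr_eq0; apply/eqP; rewrite -[LHS]mul1r.
have [||P annP] := @exists_prime T ann => //.
  split; rewrite /ann; first by rewrite mul0r.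
  - by move=> x y ex ey; rewrite mulrDl ex ey addr0.
  - by move=> r x ex; rewrite -mulrA ex mulr0.
have [c pc /annP] : exists2 c, c \notin P & c * D s = 0.
  elim: (DJ s) => [|r x z _ /(killed P)[c pc ec] _ [c' pc' ec']].
    by exists 1; [exact: spec1|rewrite mulr0].
  exists (c * c'); first exact: specNM.
  transitivity (c' * r * (c * x) + c * (c' * z)); first by ring.
  by rewrite ec ec' !mulr0 addr0.
by rewrite (negPf pc).
Qed.

Theorem theorem3p2 (R S : comPzRingType) (phi : {rmorphism R -> S})
    (phi_ft : finite_type phi) :
  ring_epimorphism phi <->
  injective (spec_map phi) /\
  forall q : spec S,
    bijective (tens_inr (loc_map q \o phi) (residue_map (spec_map phi q))).
Proof.
split=> [epi|[inj bij]].
  by split=> [|q]; [exact: epi_spec_map_inj|exact: epi_residue_bij].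
apply: fibrewise_epi => // q z.
by have [k _ kK] := bij q; exists (k z).
Qed.
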